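(* Fix $m_3\in(0,1)$. For every $\mu\in(0,\tfrac12]$ and $c<0$, consider the equilibria $(0,0,\pm r_z^* )$ on the $z$-axis of the Hill four-body problem with oblate tertiary (see context). Then at these equilibria $\Omega_{zz}$, $A$ and $D$ are negative. Consequently, of the six eigenvalues of the linearization, one pair is purely imaginary, and the two other pairs are complex conjugate (a quartet $\pm a\pm ib$ with $a,b\neq0$ real), with imaginary part close to $\pm1$ for $c$ negative and sufficiently small (i.e. $b^2\to1$ as $c\to0^-$). The linear stability is of center $\times$ complex-saddle type.
   Context: The Hill four-body problem with oblate tertiary (rotated coordinates) is the system $\ddot x-2\dot y=\Omega_x$, $\ddot y+2\dot x=\Omega_y$, $\ddot z=\Omega_z$ with $$\Omega(x,y,z)=\tfrac12(\lambda_2x^2+\lambda_1y^2-z^2)+\frac1{r}-\frac{c}{r^3}+\frac{3cz^2}{r^5},\qquad r=(x^2+y^2+z^2)^{1/2},$$ where $\lambda_1=\tfrac32(1-d)$, $\lambda_2=\tfrac32(1+d)$, $d=\sqrt{1-v^2(4-v^2)(\mu-\mu^2)}$, $v=(1-3m_3^{2/3}c)^{-1/3}$; here $c=m_3^{-2/3}R_3^2C_{20}/2<0$ is the rescaled oblateness parameter of the body of mass $m_3$. The $z$-axis equilibria are $(0,0,\pm r_z^* )$, with $r_z^*>0$ the unique positive solution of $-r^5-r^2-6c=0$. The linearization at such an equilibrium, in variables $(x,y,z,\dot x,\dot y,\dot z)$, has characteristic equation $(\rho^2-\Omega_{zz})(\rho^4+A\rho^2+B)=0$, where $A=4-\Omega_{xx}-\Omega_{yy}$,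 $B=\Omega_{xx}\Omega_{yy}$, and $D=A^2-4B$, all second derivatives being evaluated at the equilibrium. ''Center $\times$ complex-saddle'' means one pair of nonzero purely imaginary eigenvalues and a quartet $\pm a\pm ib$ with $a,b\ne0$. *)

(* Defs.v *)
From HB Require Import structures.
From mathcomp Require Import all_boot all_order all_algebra.
From mathcomp Require Import all_classical all_reals all_analysis.
From mathcomp Require Import complex.

Set Implicit Arguments.
Unset Strict Implicit.
Unset Printing Implicit Defensive.

Import Order.TTheory GRing.Theory Num.Theory.
Import numFieldNormedType.Exports.

Local Open Scope classical_set_scope.
Local Open Scope ring_scope.
Local Open Scope complex_scope.

Section Hill.
Context {R : realType}.
Implicit Types (mu c x y z : R).

Definition hill_v m3 c : R :=
  (1 - 3 * m3 `^ (2 / 3) * c) `^ (- (1 / 3)).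

Definition hill_d m3 mu c : R :=
  Num.sqrt (1 - hill_v m3 c ^+ 2 * (4 - hill_v m3 c ^+ 2) * (mu - mu ^+ 2)).

Definition lambda1 m3 mu c : R := 3 / 2 * (1 - hill_d m3 mu c).
Definition lambda2 m3 mu c : R := 3 / 2 * (1 + hill_d m3 mu c).

Definition hill_r x y z : R := Num.sqrt (x ^+ 2 + y ^+ 2 + z ^+ 2).

Definition Omega m3 mu c x y z : R :=
  1 / 2 * (lambda2 m3 mu c * x ^+ 2 + lambda1 m3 mu c * y ^+ 2 - z ^+ 2)
  + 1 / hill_r x y z - c / hill_r x y z ^+ 3
  + 3 * c * z ^+ 2 / hill_r x y z ^+ 5.

Definition Dx (f : R -> R -> R -> R) x y z : R := derive1 (fun t => f t y z) x.
Definition Dy (f : R -> R -> R -> R) x y z : R := derive1 (fun t => f x t z) y.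
Definition Dz (f : R -> R -> R -> R) x y z : R := derive1 (fun t => f x y t) z.

(* The second-order system as a first-order one in the phase variables
   (x, y, z, x', y', z'). *)
Definition hill_field m3 mu c (q : 'rV[R]_6) : 'rV[R]_6 :=
  let x := q 0 (inord 0) in let y := q 0 (inord 1) in
  let z := q 0 (inord 2) in
  let dx := q 0 (inord 3) in let dy := q 0 (inord 4) in
  let dz := q 0 (inord 5) in
  \row_(i < 6) [:: dx; dy; dz;
                   2 * dy + Dx (Omega m3 mu c) x y z;
                   - 2 * dx + Dy (Omega m3 mu c) x y z;
                   Dz (Omega m3 mu c) x y z]`_i.

(* [jacobian] acts on row vectors; the transpose is the usual matrix of the
   linearized system. *)
Definition linearization m3 mu c (q : 'rV[R]_6) : 'M[R]_6 :=
  (jacobian (hill_field m3 mu c) q)^T.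

Definition rz_eq c : set R := [set r | 0 < r /\ - r ^+ 5 - r ^+ 2 - 6 * c = 0].

(* The default value 0 is irrelevant when c < 0: see [rz_starP]. *)
Definition rz_star c : R := xget 0 (rz_eq c).

Lemma rz_eq_exists c : c < 0 -> exists r, rz_eq c r.
Proof.
move=> c0; pose p : {poly R} := 'X^5 + 'X^2 + (6 * c)%:P.
have pE r : p.[r] = r ^+ 5 + r ^+ 2 + 6 * c by rewrite !hornerE.
have c6 : 6 * c < 0 by rewrite pmulr_rlt0.
have M0 : 0 <= 1 - 6 * c by rewrite subr_ge0 (le_trans (ltW c6)).
have [||r /andP[r0 _] /rootP] := @poly_ivt _ p 0 (1 - 6 * c) => //.
  rewrite !pE !expr0n !add0r (ltW c6) /=.
  have M1 : 1 <= 1 - 6 * c by rewrite lerDl oppr_ge0 ltW.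
  have M2 : 1 - 6 * c <= (1 - 6 * c) ^+ 2 by rewrite expr2 ler_peMl.
  rewrite -addrA addr_ge0 ?exprn_ge0 // -lerBlDr sub0r.
  by apply: le_trans M2; rewrite lerDr.
rewrite pE => r_root; exists r; split; last first.
  by apply/eqP; rewrite -opprD -opprD oppr_eq0 r_root.
rewrite lt_neqAle r0 andbT; apply/eqP => r00.
by move: r_root c6; rewrite -r00 !expr0n !add0r => ->; rewrite ltxx.
Qed.

Lemma rz_eq_unique c r s : rz_eq c r -> rz_eq c s -> r = s.
Proof.
move=> [r0 rE] [s0 sE].
have E : r ^+ 5 + r ^+ 2 = s ^+ 5 + s ^+ 2.
  by apply: oppr_inj; rewrite !opprD; apply: (addIr (- (6 * c))); rewrite rE sE.
have mono (u v : R) : 0 < u -> u < v -> u ^+ 5 + u ^+ 2 < v ^+ 5 + v ^+ 2.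
  move=> u0 uv.
  by apply: ltrD; rewrite ltrXn2r ?uv // ltW // (lt_trans u0 uv).
case: (ltgtP r s) => // [/(mono _ _ r0)|/(mono _ _ s0)];
  by rewrite E ltxx.
Qed.

Lemma rz_starP c : c < 0 -> rz_eq c (rz_star c).
Proof. by move=> /rz_eq_exists[r rP]; exact: (xgetPex 0 (ex_intro _ r rP)). Qed.

(* [s] selects the sign: false for + rz_star, true for - rz_star. *)
Definition z_eq c (s : bool) : R := (-1) ^+ s * rz_star c.

Definition z_equilibrium c (s : bool) : 'rV[R]_6 :=
  \row_(i < 6) [:: 0; 0; z_eq c s; 0; 0; 0]`_i.

Definition Omega_xx m3 mu c s : R := Dx (Dx (Omega m3 mu c)) 0 0 (z_eq c s).
Definition Omega_yy m3 mu c s : R := Dy (Dy (Omega m3 mu c)) 0 0 (z_eq c s).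
Definition Omega_zz m3 mu c s : R := Dz (Dz (Omega m3 mu c)) 0 0 (z_eq c s).

Definition coefA m3 mu c s : R := 4 - Omega_xx m3 mu c s - Omega_yy m3 mu c s.
Definition coefB m3 mu c s : R := Omega_xx m3 mu c s * Omega_yy m3 mu c s.
Definition discD m3 mu c s : R := coefA m3 mu c s ^+ 2 - 4 * coefB m3 mu c s.

(* The complex eigenvalues of a real matrix, listed with multiplicity. *)
Definition has_eigenvalues n (M : 'M[R]_n) (l : seq R[i]) : Prop :=
  char_poly (map_mx (real_complex R) M) = \prod_(rho <- l) ('X - rho%:P).

Definition center_quartet (M : 'M[R]_6) (w a b : R) : Prop :=
  [/\ w != 0, a != 0, b != 0 &
      has_eigenvalues M
        [:: 0 +i* w; 0 -i* w; a +i* b; a -i* b; (- a) +i* b; (- a) -i* b]].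

Definition center_complex_saddle (M : 'M[R]_6) : Prop :=
  exists w a b : R, center_quartet M w a b.

End Hill.

(* Main.v *)
Require Import Defs.
From HB Require Import structures.
From mathcomp Require Import all_boot all_order all_algebra.
From mathcomp Require Import all_classical all_reals all_analysis.
From mathcomp Require Import complex ring lra.

Set Implicit Arguments.
Unset Strict Implicit.
Unset Printing Implicit Defensive.

Import Order.TTheory GRing.Theory Num.Theory.
Import numFieldNormedType.Exports.

Local Open Scope classical_set_scope.
Local Open Scope ring_scope.

(* With u = 1 / r^3, the equation of r = rz_star gives 12 c / r^5 = - 2 - 2 u, so
   that Omega_xx = lambda2 + 2 + u, Omega_yy = lambda1 + 2 + u and
   Omega_zz = - 5 - 2 u. Hence A = - 3 - 2 u and D = - 40 - 16 u + 9 d^2, which is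
   negative because 0 <= d <= 1. The roots of rho^4 + A rho^2 + B are then
   +-a +-ib with a^2 = (2 sqrt B - A) / 4 and b^2 = (2 sqrt B + A) / 4, and
   1 - b^2 = (7 / 2 + u - sqrt B) / 2 <= 9 / (8 u), which tends to 0 with r since
   r^2 <= - 6 c. *)

(** * Locality and assembly of differentials *)

Section Differentials.
Context {R : realType}.

(** A differential depends only on the germ at [p]: the first-order expansion of [f] is also one for
    [g], and it determines the differential. This is what allows differentiating closed forms of the
    partials of [Omega] that hold only off the plane z = 0. *)
Lemma near_eq_is_diff (V W : normedModType R) (f g df : V -> W) (p : V) :
  (\forall q \near p, f q = g q) -> is_diff p f df -> is_diff p g df.
Proof.
move=> fg fP; have [dfp dfE] := fP.
have gp : f p = g p by exact: nbhs_singleton fg.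
have gE : g \o shift p = cst (g p) + 'd f p +o_ 0 id.
  apply/eqaddoP => e e0.
  have /eqaddoP/(_ e e0) := diff_locally dfp.
  move: fg; rewrite (near_shift 0) subr0; apply: filterS2 => h /= fgh.
  by rewrite !fctE /= fgh gp.
have dgE : 'd g p = 'd f p :> (V -> W).
  by apply: diff_unique => //; exact: diff_continuous.
apply: DiffDef; last by rewrite dgE.
by apply/diff_locallyP; rewrite dgE; split => //; exact: diff_continuous.
Qed.

(** The row is a finite sum of scalar functions times constant basis vectors, so it is
    differentiated term by term. *)
Lemma is_diff_row (V : normedModType R) n (F dF : 'I_n -> V -> R) (p : V) :
  (forall i, is_diff p (F i) (dF i)) ->
  is_diff p (fun q => \row_i F i q) (fun h => \row_i dF i h).
Proof.
move=> FP.
have rowE (G : 'I_n -> V -> R) :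
    (fun q => \row_i G i q) = \sum_i (fun q => G i q *: 'e_i) :> (V -> 'rV[R]_n).
  apply/funext => q; rewrite fct_sumE; apply/rowP => j.
  rewrite mxE summxE (bigD1 j)//= big1 ?addr0 ?mxE ?eqxx ?mulr1// => i ij.
  by rewrite !mxE eqxx /= eq_sym (negbTE ij) mulr0.
rewrite !rowE; elim/big_ind2 : _ => [|f df g dg fP gP|i _].
- exact: is_diff_cst.
- exact: is_diffD.
- have [di dE] := FP i; apply: DiffDef; first exact: differentiableZl.
  by rewrite diffZl// dE.
Qed.

Lemma is_diff_derive1 (f df : R -> R) (x : R) :
  is_diff x f df -> derive1 f x = df 1.
Proof. by move=> [dfx <-]; rewrite derive1E'. Qed.

End Differentials.

(* [hill_pull c k 0] and [hill_pull c k 1] are Omega_x / x (or Omega_y / y) and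
   Omega_z / z off the plane z = 0, where k is the coefficient of x ^+ 2 / 2,
   y ^+ 2 / 2 or z ^+ 2 / 2 in Omega. *)
Definition hill_pull {R : realType} (c k m x y z : R) : R :=
  k - (hill_r x y z)^-1 ^+ 3 + 3 * c * (1 + 2 * m) * (hill_r x y z)^-1 ^+ 5
  - 15 * c * z ^+ 2 * (hill_r x y z)^-1 ^+ 7.

(* The coordinates are arbitrary differentiable functions on a normed space V:
   V = R gives the partial derivatives, V = 'rV_6 the jacobian. *)
Section Potential.
Context {R : realType} (V : normedModType R).
Variables (X Y Z dX dY dZ : V -> R) (p : V).
Hypotheses (Xp : is_diff p X dX) (Yp : is_diff p Y dY) (Zp : is_diff p Z dZ).

Lemma hill_r_gt0 (x y z : R) : z != 0 -> 0 < hill_r x y z.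
Proof.
move=> z0; rewrite sqrtr_gt0 ltr_wpDl ?addr_ge0 ?sqr_ge0//.
by rewrite exprn_even_gt0.
Qed.

(** [Omega] is polynomial in the coordinates and 1 / r, so this is the only place where the square
    root itself is differentiated. *)
Lemma is_diff_invr : Z p != 0 ->
  is_diff p (fun q => (hill_r (X q) (Y q) (Z q))^-1)
    (fun h => - (hill_r (X p) (Y p) (Z p))^-1 ^+ 3 *
       (X p * dX h + Y p * dY h + Z p * dZ h)).
Proof.
move=> Zp0.
pose N : V -> R := X ^+ 2 + Y ^+ 2 + Z ^+ 2.
have r0 := hill_r_gt0 (X p) (Y p) Zp0.
have NE q : hill_r (X q) (Y q) (Z q) = Num.sqrt (N q) by [].
have N0 : 0 < N p by rewrite -sqrtr_gt0 -NE.
have sP : is_diff (N p) (fun t : R => (Num.sqrt t)^-1)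
    (fun t => - (Num.sqrt (N p))^-1 ^+ 3 / 2 * t).
  have [ds dsE] := is_derive1_sqrt N0.
  have ds' : differentiable Num.sqrt (N p) by exact/derivable1_diffP.
  have sN0 : Num.sqrt (N p) != 0 by rewrite -NE gt_eqF.
  apply: DiffDef; first exact: differentiableV.
  rewrite diffV// deriv1E//; apply/funext => t /=.
  rewrite derive1E dsE -[_ *: _]/(_ * (t * _)).
  by field.
have NP : is_diff p N (2 * X p *: dX + 2 * Y p *: dY + 2 * Z p *: dZ).
  (* The numeral given to [is_diffX] is the exponent minus one, here and below. *)
  have N' := is_diffD (is_diffD (is_diffX 1 Xp) (is_diffX 1 Yp)) (is_diffX 1 Zp).
  by apply: is_diff_eq N' _; rewrite !expr1.
have QP := is_diff_comp NP sP.
apply: (is_diff_eq QP).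
apply/funext => h; rewrite /= !fctE NE -![_ *: _]/(_ * _).
by move: (_ (N p))^-1 => Q; field.
Qed.

Local Notation rp := (hill_r (X p) (Y p) (Z p)).
Local Notation sp h := (X p * dX h + Y p * dY h + Z p * dZ h).

Lemma is_diff_Omega (m3 mu c : R) : Z p != 0 ->
  is_diff p (fun q => Omega m3 mu c (X q) (Y q) (Z q))
    (fun h => X p * hill_pull c (lambda2 m3 mu c) 0 (X p) (Y p) (Z p) * dX h +
              Y p * hill_pull c (lambda1 m3 mu c) 0 (X p) (Y p) (Z p) * dY h +
              Z p * hill_pull c (-1) 1 (X p) (Y p) (Z p) * dZ h).
Proof.
move=> Zp0; have QP := is_diff_invr Zp0.
set Q := (fun _ => _^-1) in QP.
(* With [Q] = 1 / r, [Omega] becomes a polynomial in [X], [Y], [Z] and [Q], to which the sum,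
   product and power rules apply. *)
have OE : (fun q => Omega m3 mu c (X q) (Y q) (Z q)) =
    (1 / 2) *: (lambda2 m3 mu c *: X ^+ 2 + lambda1 m3 mu c *: Y ^+ 2 - Z ^+ 2)
    + Q - c *: Q ^+ 3 + (3 * c) *: (Z ^+ 2 * Q ^+ 5).
  apply/funext => q; rewrite !fctE -![_ *: _]/(_ * _) /Q /Omega -!exprVn !div1r.
  by move: (hill_r _ _ _)^-1 => r; rewrite ?mulrA.
rewrite OE.
have OP := is_diffD (is_diffB (is_diffD (is_diffZ (1 / 2)
  (is_diffB (is_diffD (is_diffZ (lambda2 m3 mu c) (is_diffX 1 Xp))
                      (is_diffZ (lambda1 m3 mu c) (is_diffX 1 Yp)))
            (is_diffX 1 Zp))) QP) (is_diffZ c (is_diffX 2 QP)))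
  (is_diffZ (3 * c) (is_diffM (is_diffX 1 Zp) (is_diffX 4 QP))).
apply: (is_diff_eq OP).
apply/funext => h; rewrite !fctE -![_ *: _]/(_ * _) /hill_pull /Q.
by move: (hill_r _ _ _)^-1 => r; field.
Qed.

Lemma is_diff_hill_pull (c k m : R) : Z p != 0 ->
  is_diff p (fun q => hill_pull c k m (X q) (Y q) (Z q))
    (fun h => 3 * rp^-1 ^+ 5 * sp h - 15 * c * (1 + 2 * m) * rp^-1 ^+ 7 * sp h
              - 30 * c * Z p * rp^-1 ^+ 7 * dZ h
              + 105 * c * Z p ^+ 2 * rp^-1 ^+ 9 * sp h).
Proof.
move=> Zp0; have QP := is_diff_invr Zp0.
set Q := (fun _ => _^-1) in QP.
have GE : (fun q => hill_pull c k m (X q) (Y q) (Z q)) =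
    cst k - Q ^+ 3 + (3 * c * (1 + 2 * m)) *: Q ^+ 5
    - (15 * c) *: (Z ^+ 2 * Q ^+ 7).
  apply/funext => q; rewrite !fctE -![_ *: _]/(_ * _) /Q /hill_pull.
  by move: (hill_r _ _ _)^-1 => r; rewrite ?mulrA.
rewrite GE.
have GP := is_diffB (is_diffD (is_diffB (is_diff_cst k p) (is_diffX 2 QP))
    (is_diffZ (3 * c * (1 + 2 * m)) (is_diffX 4 QP)))
  (is_diffZ (15 * c) (is_diffM (is_diffX 1 Zp) (is_diffX 6 QP))).
apply: (is_diff_eq GP).
apply/funext => h; rewrite !fctE -![_ *: _]/(_ * _) /Q.
(* The term removed is the differential of the constant [k]. *)
rewrite [X in X - _ + _](_ : _ = 0)//.
by move: (hill_r _ _ _)^-1 => r; ring.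
Qed.

End Potential.

(** * First partial derivatives of the potential *)

Section FirstPartials.
Context {R : realType}.
Variables (m3 mu c x y z : R).
Hypothesis z0 : z != 0.

Lemma Dx_Omega :
  Dx (Omega m3 mu c) x y z = x * hill_pull c (lambda2 m3 mu c) 0 x y z.
Proof.
have /is_diff_derive1 := is_diff_Omega (is_diff_id x) (is_diff_cst y x)
  (is_diff_cst z x) m3 mu c z0.
by rewrite /Dx => ->; rewrite !mulr0 mulr1 !addr0.
Qed.

Lemma Dy_Omega :
  Dy (Omega m3 mu c) x y z = y * hill_pull c (lambda1 m3 mu c) 0 x y z.
Proof.
have /is_diff_derive1 := is_diff_Omega (is_diff_cst x y) (is_diff_id y)
  (is_diff_cst z y) m3 mu c z0.
by rewrite /Dy => ->; rewrite !mulr0 mulr1 add0r addr0.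
Qed.

Lemma Dz_Omega :
  Dz (Omega m3 mu c) x y z = z * hill_pull c (-1) 1 x y z.
Proof.
have /is_diff_derive1 := is_diff_Omega (is_diff_cst x z) (is_diff_cst y z)
  (is_diff_id z) m3 mu c z0.
by rewrite /Dz => ->; rewrite !mulr0 mulr1 !add0r.
Qed.
End FirstPartials.

(** * Second derivatives of the potential on the z-axis *)

Section OnTheAxis.
Context {R : realType} (V : normedModType R).
Variables (m3 mu c : R) (X Y Z dX dY dZ : V -> R) (p : V).
Hypotheses (Xp : is_diff p X dX) (Yp : is_diff p Y dY) (Zp : is_diff p Z dZ).
Hypotheses (X0 : X p = 0) (Y0 : Y p = 0) (Z0 : Z p != 0).

Lemma hill_r_axis (z : R) : hill_r 0 0 z = `|z|.
Proof. by rewrite /hill_r expr0n !add0r sqrtr_sqr. Qed.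

(** By continuity of [Z], the closed forms of the first partials are valid on a whole neighbourhood
    of [p]. *)
Lemma near_neq0 : \forall q \near p, Z q != 0.
Proof.
have [Zd _] := Zp.
have /cvgr_neq0 : Z q @[q --> p] --> Z p.
  exact: differentiable_continuous.
exact.
Qed.

Local Notation u := (`|Z p|^-1).

(** On the axis r = |z|; this relation lets [ring] trade each factor z^2 for r^2. *)
Let uZ : u ^+ 2 * Z p ^+ 2 = 1.
Proof. by rewrite exprVn real_normK ?num_real// mulVf// expf_neq0. Qed.

(** As [X p] = 0, the product rule leaves only [hill_pull] at [p] times [dX], so the mixed second
    partials vanish. The coefficient - 12 c is 3 c - 15 c. *)
Lemma is_diff_Dx_Omega :
  is_diff p (fun q => Dx (Omega m3 mu c) (X q) (Y q) (Z q))
    (fun h => (lambda2 m3 mu c - u ^+ 3 - 12 * c * u ^+ 5) * dX h).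
Proof.
apply: (@near_eq_is_diff _ _ _
  (fun q => X q * hill_pull c (lambda2 m3 mu c) 0 (X q) (Y q) (Z q))).
  by have := near_neq0; apply: filterS => q q0; rewrite Dx_Omega.
have FP := is_diffM Xp (is_diff_hill_pull Xp Yp Zp c (lambda2 m3 mu c) 0 Z0).
apply: (is_diff_eq FP); apply/funext => h.
rewrite !fctE -![_ *: _]/(_ * _) X0 Y0 /hill_pull hill_r_axis.
by ring: uZ.
Qed.

Lemma is_diff_Dy_Omega :
  is_diff p (fun q => Dy (Omega m3 mu c) (X q) (Y q) (Z q))
    (fun h => (lambda1 m3 mu c - u ^+ 3 - 12 * c * u ^+ 5) * dY h).
Proof.
apply: (@near_eq_is_diff _ _ _
  (fun q => Y q * hill_pull c (lambda1 m3 mu c) 0 (X q) (Y q) (Z q))).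
  by have := near_neq0; apply: filterS => q q0; rewrite Dy_Omega.
have FP := is_diffM Yp (is_diff_hill_pull Xp Yp Zp c (lambda1 m3 mu c) 0 Z0).
apply: (is_diff_eq FP); apply/funext => h.
rewrite !fctE -![_ *: _]/(_ * _) X0 Y0 /hill_pull hill_r_axis.
by ring: uZ.
Qed.

Lemma is_diff_Dz_Omega :
  is_diff p (fun q => Dz (Omega m3 mu c) (X q) (Y q) (Z q))
    (fun h => (-1 + 2 * u ^+ 3 + 24 * c * u ^+ 5) * dZ h).
Proof.
apply: (@near_eq_is_diff _ _ _
  (fun q => Z q * hill_pull c (-1) 1 (X q) (Y q) (Z q))).
  by have := near_neq0; apply: filterS => q q0; rewrite Dz_Omega.
have FP := is_diffM Zp (is_diff_hill_pull Xp Yp Zp c (-1) 1 Z0).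
apply: (is_diff_eq FP); apply/funext => h.
rewrite !fctE -![_ *: _]/(_ * _) X0 Y0 /hill_pull hill_r_axis.
by ring: uZ.
Qed.

End OnTheAxis.

(** * The characteristic determinant and its complex factorization *)

Section CharacteristicPolynomial.

(* Laplace expansion along the first row with entries indexed by nat, so that
   it computes on a concrete matrix. *)
Fixpoint nat_det {K : pzRingType} n (f : nat -> nat -> K) : K :=
  if n is m.+1 then
    \sum_(j <- iota 0 n)
      f 0%N j * ((-1) ^+ j * nat_det m (fun i k => f i.+1 (bump j k)))
  else 1.

Lemma nat_detS (K : pzRingType) n (f : nat -> nat -> K) :
  nat_det n.+1 f = \sum_(j <- iota 0 n.+1)
      f 0%N j * ((-1) ^+ j * nat_det n (fun i k => f i.+1 (bump j k))).
Proof. by []. Qed.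

#[local] Arguments nat_det : simpl never.

Lemma det_natE (K : comNzRingType) n (f : nat -> nat -> K) :
  \det (\matrix_(i < n, j < n) f i j) = nat_det n f.
Proof.
elim: n f => [|n IHn] f; first by rewrite det_mx00.
rewrite (expand_det_row _ ord0) nat_detS -[iota 0 _]/(index_iota 0 n.+1) big_mkord.
apply: eq_bigr => j _; rewrite mxE -IHn.
congr (_ * (_ * \det _)); apply/matrixP => i k; rewrite !mxE.
by rewrite /= /bump leq0n.
Qed.

(** This is the characteristic matrix of the linearization: [a], [b], [c] stand for the second
    partials in xx, yy, zz (here [c] is not the oblateness), and the entries -2 and 2 come from the
    Coriolis terms. *)
Lemma det_hill (K : comNzRingType) (x a b c : K) :
  \det (\matrix_(i < 6, j < 6) (nth [::] [:: [:: x; 0; 0; -1; 0; 0];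
                                   [:: 0; x; 0; 0; -1; 0];
                                   [:: 0; 0; x; 0; 0; -1];
                                   [:: -a; 0; 0; x; -2; 0];
                                   [:: 0; -b; 0; 2; x; 0];
                                   [:: 0; 0; -c; 0; 0; x]] i)`_j) =
  (x ^+ 2 - c) * (x ^+ 4 + (4 - a - b) * x ^+ 2 + a * b).
Proof.
rewrite (det_natE 6 (fun i j => (nth [::] _ i)`_j)).
have simp := (mul0r, mulr0, mul1r, add0r, addr0).
(* Each pass expands one row and drops the vanishing terms before the next expansion. *)
do 6!rewrite !nat_detS /iota !big_cons !big_nil /= ?simp.
rewrite /nat_det; ring.
Qed.

End CharacteristicPolynomial.

(** Pairing conjugate roots gives real quadratics, so factorizations over R[i] can be compared over
    R. *)
Lemma conj_factors (R : rcfType) (x y : R) :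
  ('X - (x +i* y)%C%:P) * ('X - (x -i* y)%C%:P) =
  map_poly (real_complex R) ('X ^+ 2 - (2 * x)%:P * 'X + (x ^+ 2 + y ^+ 2)%:P).
Proof.
rewrite !(rmorphD, rmorphN, rmorphM, rmorphXn) /= map_polyX !map_polyC /=.
have -> : (x +i* y)%C = x%:C%C + 'i%C * y%:C%C :> R[i].
  by rewrite [LHS]complexE.
have -> : (x -i* y)%C = x%:C%C - 'i%C * y%:C%C :> R[i].
  by rewrite [LHS]complexE/= rmorphN mulrN.
have i2 := sqr_i R.
rewrite !(polyCD, polyCN, polyCM, polyC_exp, rmorphD, rmorphM, rmorphXn) /=.
have iP : ('i%C : R[i])%:P ^+ 2 = -1 :> {poly R[i]} by rewrite -polyC_exp i2 polyCN.
ring: iP.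
Qed.

(** The quartet contributes (X^2 - 2 a X + a^2 + b^2) (X^2 + 2 a X + a^2 + b^2), that is (X^2 + a^2
    + b^2)^2 - 4 a^2 X^2, whose coefficients are the stated [A] and [B]. *)
Lemma quartet_eigenvalues (R : rcfType) (M : 'M[R]_6) (w a b A B : R) :
  char_poly M = ('X ^+ 2 + (w ^+ 2)%:P) * ('X ^+ 4 + A%:P * 'X ^+ 2 + B%:P) ->
  A = 2 * (b ^+ 2 - a ^+ 2) -> B = (a ^+ 2 + b ^+ 2) ^+ 2 ->
  char_poly (map_mx (real_complex R) M) =
  \prod_(rho <- [:: 0 +i* w; 0 -i* w; a +i* b; a -i* b; (- a) +i* b;
                   (- a) -i* b]%C) ('X - rho%:P).
Proof.
move=> MP AE BE; rewrite -map_char_poly MP !big_cons big_nil mulr1.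
rewrite [RHS](_ : _ = (('X - (0 +i* w)%C%:P) * ('X - (0 -i* w)%C%:P)) *
  ((('X - (a +i* b)%C%:P) * ('X - (a -i* b)%C%:P)) *
   (('X - (- a +i* b)%C%:P) * ('X - (- a -i* b)%C%:P)))); last by rewrite !mulrA.
rewrite !conj_factors -!rmorphM /=; congr (map_poly _ _).
rewrite AE BE !(polyCD, polyCN, polyCM, polyC_exp, polyCMn); ring.
Qed.

(** The hypothesis has the shape produced by a differential evaluated at basis vectors: each
    coordinate becomes a Kronecker symbol in [j]. *)
Lemma char_poly_hill (K : comNzRingType) (M : 'M[K]_6) (a b c : K) :
  (forall i j, M i j =
    [:: (j == 3 :> nat)%:R; (j == 4 :> nat)%:R; (j == 5 :> nat)%:R;
        2 * (j == 4 :> nat)%:R + a * (j == 0 :> nat)%:R;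
        - 2 * (j == 3 :> nat)%:R + b * (j == 1 :> nat)%:R;
        c * (j == 2 :> nat)%:R]`_i) ->
  char_poly M = ('X ^+ 2 - c%:P) *
                ('X ^+ 4 + (4 - a - b)%:P * 'X ^+ 2 + (a * b)%:P).
Proof.
have two : 2%:P = 2 :> {poly K} by rewrite -[2]/(1 + 1) polyCD.
move=> ME; rewrite !polyCD !polyCN polyCM !polyC1 -[1 + (1 + (1 + 1))]/4 -det_hill.
congr (\det _); apply/matrixP => i j; rewrite !mxE ME.
case: i => -[|[|[|[|[|[|//]]]]]] lti;
  case: j => -[|[|[|[|[|[|//]]]]]] ltj /=;
  rewrite ?(mulr0n, mulr1n, mulr0, mulr1, addr0, add0r, polyC0);
  by rewrite ?subr0 ?sub0r ?oppr0 ?polyCN ?two ?opprK.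
Qed.

(** * Second derivatives and linearization at the equilibria *)

Section Equilibrium.
Context {R : realType}.
Implicit Types (mu c : R) (s : bool).

Local Notation u c := ((rz_star c)^-1 ^+ 3).

Lemma rz_star_gt0 c : c < 0 -> 0 < rz_star c.
Proof. by case/rz_starP. Qed.

Lemma norm_z_eq c s : c < 0 -> `|z_eq c s| = rz_star c.
Proof. by move=> c0; rewrite /z_eq normrMsign gtr0_norm// rz_star_gt0. Qed.

Lemma z_eq_neq0 c s : c < 0 -> z_eq c s != 0.
Proof. by move=> c0; rewrite -normr_gt0 norm_z_eq// rz_star_gt0. Qed.

Lemma rz_star_inv c : c < 0 -> 12 * c * (rz_star c)^-1 ^+ 5 = - 2 - 2 * u c.
Proof.
move=> c0; have [r0 rE] := rz_starP c0.
have {}r0 : rz_star c != 0 by rewrite gt_eqF.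
have -> : 12 * c = - 2 * (rz_star c ^+ 5 + rz_star c ^+ 2) by lra.
by field.
Qed.

Lemma Omega_xxE m3 mu c s : c < 0 ->
  Omega_xx m3 mu c s = lambda2 m3 mu c + 2 + u c.
Proof.
move=> c0; have z0 := z_eq_neq0 s c0.
have H : Omega_xx m3 mu c s = _ :=
  is_diff_derive1 (is_diff_Dx_Omega m3 mu c
    (is_diff_id 0) (is_diff_cst 0 0) (is_diff_cst (z_eq c s) 0)
    erefl erefl z0).
rewrite H mulr1 /= norm_z_eq// rz_star_inv//; ring.
Qed.

Lemma Omega_yyE m3 mu c s : c < 0 ->
  Omega_yy m3 mu c s = lambda1 m3 mu c + 2 + u c.
Proof.
move=> c0; have z0 := z_eq_neq0 s c0.
have H : Omega_yy m3 mu c s = _ :=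
  is_diff_derive1 (is_diff_Dy_Omega m3 mu c
    (is_diff_cst 0 0) (is_diff_id 0) (is_diff_cst (z_eq c s) 0)
    erefl erefl z0).
rewrite H mulr1 /= norm_z_eq// rz_star_inv//; ring.
Qed.

Lemma Omega_zzE m3 mu c s : c < 0 -> Omega_zz m3 mu c s = - 5 - 2 * u c.
Proof.
move=> c0; have z0 := z_eq_neq0 s c0.
have H : Omega_zz m3 mu c s = _ :=
  is_diff_derive1 (is_diff_Dz_Omega m3 mu c
    (is_diff_cst 0 (z_eq c s)) (is_diff_cst 0 (z_eq c s))
    (is_diff_id (z_eq c s)) erefl erefl z0).
rewrite H mulr1 /= norm_z_eq//.
rewrite (_ : 24 * c * _ = 2 * (12 * c * (rz_star c)^-1 ^+ 5)); last by ring.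
by rewrite rz_star_inv//; ring.
Qed.

Lemma coefAE m3 mu c s : c < 0 -> coefA m3 mu c s = - 3 - 2 * u c.
Proof.
move=> c0; rewrite /coefA Omega_xxE// Omega_yyE// /lambda1 /lambda2.
by move: (_ ^+ 3) => t; field.
Qed.

(* Unqualified, [coefB] is the polynomial lemma of MathComp. *)
Lemma coefBE m3 mu c s : c < 0 ->
  Defs.coefB m3 mu c s = (7 / 2 + u c) ^+ 2 - 9 / 4 * hill_d m3 mu c ^+ 2.
Proof.
move=> c0; rewrite /Defs.coefB Omega_xxE// Omega_yyE// /lambda1 /lambda2.
by move: (_ ^+ 3) => t; field.
Qed.

Lemma discDE m3 mu c s : c < 0 ->
  discD m3 mu c s = - 40 - 16 * u c + 9 * hill_d m3 mu c ^+ 2.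
Proof.
move=> c0; rewrite /discD coefAE// coefBE//.
by move: (_ ^+ 3) => t; field.
Qed.

(** A matrix entry is a continuous linear form, hence its own differential. *)
Lemma is_diff_coord m n (M : 'M[R]_(m.+1, n.+1)) i j :
  is_diff M (fun N : 'M[R]_(m.+1, n.+1) => N i j) (fun N => N i j).
Proof.
have lin : linear (fun N : 'M[R]_(m.+1, n.+1) => N i j).
  by move=> k A B; rewrite !mxE.
pose fM := GRing.isLinear.Build _ _ _ _ _ lin.
pose f : {linear 'M[R]_(m.+1, n.+1) -> R} :=
  HB.pack (fun N : 'M[R]_(m.+1, n.+1) => N i j) fM.
have fc : continuous f by exact: coord_continuous.
apply: DiffDef; first exact: (linear_differentiable (f := f)).
exact: (diff_lin (f := f)).
Qed.

Lemma is_diff_hill_field m3 mu c s : c < 0 ->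
  is_diff (z_equilibrium c s) (hill_field m3 mu c)
    (fun h => \row_(i < 6)
      [:: h 0 (inord 3); h 0 (inord 4); h 0 (inord 5);
          2 * h 0 (inord 4) + Omega_xx m3 mu c s * h 0 (inord 0);
          - 2 * h 0 (inord 3) + Omega_yy m3 mu c s * h 0 (inord 1);
          Omega_zz m3 mu c s * h 0 (inord 2)]`_i).
Proof.
move=> c0; apply: is_diff_row => i.
have Q (j : 'I_6) := is_diff_coord (z_equilibrium c s) 0 j.
have X0 : z_equilibrium c s 0 (inord 0) = 0 by rewrite mxE inordK.
have Y0 : z_equilibrium c s 0 (inord 1) = 0 by rewrite mxE inordK.
have ZE : z_equilibrium c s 0 (inord 2) = z_eq c s by rewrite mxE inordK.
have Z0 : z_equilibrium c s 0 (inord 2) != 0 by rewrite ZE z_eq_neq0.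
have DX := is_diff_Dx_Omega m3 mu c (Q _) (Q _) (Q _) X0 Y0 Z0.
have DY := is_diff_Dy_Omega m3 mu c (Q _) (Q _) (Q _) X0 Y0 Z0.
have DZ := is_diff_Dz_Omega m3 mu c (Q _) (Q _) (Q _) X0 Y0 Z0.
case: i => -[|[|[|[|[|[|//]]]]]] lti /=; do ?exact: Q.
- apply: (is_diff_eq (is_diffD (is_diffZ 2 (Q (inord 4))) DX)).
  apply/funext => h; rewrite !fctE -![_ *: _]/(_ * _) ZE norm_z_eq//.
  by rewrite rz_star_inv// Omega_xxE//; ring.
- apply: (is_diff_eq (is_diffD (is_diffZ (-2) (Q (inord 3))) DY)).
  apply/funext => h; rewrite !fctE -![_ *: _]/(_ * _) ZE norm_z_eq//.
  by rewrite rz_star_inv// Omega_yyE//; ring.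
- apply: (is_diff_eq DZ); apply/funext => h; rewrite ZE norm_z_eq//.
  rewrite (_ : 24 * c * _ = 2 * (12 * c * (rz_star c)^-1 ^+ 5)); last by ring.
  by rewrite rz_star_inv// Omega_zzE//; ring.
Qed.

Lemma char_poly_linearization m3 mu c s : c < 0 ->
  char_poly (linearization m3 mu c (z_equilibrium c s)) =
  ('X ^+ 2 - (Omega_zz m3 mu c s)%:P) *
  ('X ^+ 4 + (coefA m3 mu c s)%:P * 'X ^+ 2 + (Defs.coefB m3 mu c s)%:P).
Proof.
move=> c0; have [_ dE] := is_diff_hill_field m3 mu s c0.
apply: char_poly_hill => i j; rewrite !mxE dE !mxE.
case: i => -[|[|[|[|[|[|//]]]]]] lti /=;
  rewrite -!(inj_eq val_inj) /= !inordK//; rewrite !(eq_sym (_ : nat) (j : nat))//.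
Qed.
End Equilibrium.

(** * Signs, eigenvalues and the limit of the imaginary part *)

Section Spectrum.
Context {R : realType} (m3 mu : R).
Hypotheses (mu_gt0 : 0 < mu) (mu_le : mu <= 1 / 2).
Implicit Types (c : R) (s : bool).

(** [Num.sqrt] is nonnegative and monotone, so it suffices that the radicand is at most 1. This
    follows from 0 <= v <= 1 and mu - mu^2 >= 0. *)
Lemma hill_d_itv01 c : c < 0 -> 0 <= hill_d m3 mu c <= 1.
Proof.
move=> c0; rewrite sqrtr_ge0 /= -[leRHS]sqrtr1 ler_sqrt //.
have v01 : 0 <= hill_v m3 c <= 1.
  (* 1 is written as the zeroth power of the base of v, which is at least 1 because c < 0; the
     exponent - 1 / 3 is below 0. *)
  rewrite powR_ge0 /= -[leRHS](powRr0 (1 - 3 * m3 `^ (2 / 3) * c)).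
  apply: ler_powR; last by lra.
  by rewrite lerDl oppr_ge0 mulr_ge0_le0 ?mulr_ge0 ?powR_ge0// ltW.
rewrite lerBlDl lerDr mulr_ge0//; last first.
  rewrite (_ : mu - mu ^+ 2 = mu * (1 - mu)); last by ring.
  by rewrite mulr_ge0//; have := mu_gt0; have := mu_le; lra.
by rewrite mulr_ge0 ?sqr_ge0//; nra.
Qed.

Lemma rz_star_inv3_gt0 c : c < 0 -> 0 < (rz_star c)^-1 ^+ 3.
Proof. by move=> c0; rewrite exprn_gt0// invr_gt0 rz_star_gt0. Qed.

Lemma Omega_zz_lt0 c s : c < 0 -> Omega_zz m3 mu c s < 0.
Proof. by move=> c0; rewrite Omega_zzE//; have := rz_star_inv3_gt0 c0; lra. Qed.

Lemma coefA_lt0 c s : c < 0 -> coefA m3 mu c s < 0.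
Proof. by move=> c0; rewrite coefAE//; have := rz_star_inv3_gt0 c0; lra. Qed.

Lemma discD_lt0 c s : c < 0 -> discD m3 mu c s < 0.
Proof.
move=> c0; rewrite discDE//; have := rz_star_inv3_gt0 c0.
by have /andP[] := hill_d_itv01 c0; nra.
Qed.

(** D < 0 says A^2 < 4 B; with A < 0, square roots give the claim. It makes the radicands defining
    [a] and [b] positive. *)
Lemma sqrt_coefB_gt c s : c < 0 ->
  - coefA m3 mu c s < 2 * Num.sqrt (Defs.coefB m3 mu c s) :> R.
Proof.
move=> c0; have D0 := discD_lt0 s c0; have A0 := coefA_lt0 s c0.
have B0 : 0 < Defs.coefB m3 mu c s by move: D0; rewrite /discD; nra.
rewrite -(@ltr_pXn2r _ 2)// ?nnegrE ?mulr_ge0 ?sqrtr_ge0 ?oppr_ge0 ?(ltW A0)//.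
rewrite exprMn sqr_sqrtr ?(ltW B0)// sqrrN.
by move: D0; rewrite /discD; lra.
Qed.

Let w c s : R := Num.sqrt (- Omega_zz m3 mu c s).
Let a c s : R :=
  Num.sqrt ((2 * Num.sqrt (Defs.coefB m3 mu c s) - coefA m3 mu c s) / 4).
Let b c s : R :=
  Num.sqrt ((2 * Num.sqrt (Defs.coefB m3 mu c s) + coefA m3 mu c s) / 4).

(** The choices give a^2 + b^2 = sqrt B and b^2 - a^2 = A / 2, as [quartet_eigenvalues] requires. *)
Lemma hill_quartet c s : c < 0 ->
  center_quartet (linearization m3 mu c (z_equilibrium c s))
    (w c s) (a c s) (b c s).
Proof.
move=> c0; have Z0 := Omega_zz_lt0 s c0; have A0 := coefA_lt0 s c0.
have SA := sqrt_coefB_gt s c0.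
have a0 : 0 < (2 * Num.sqrt (Defs.coefB m3 mu c s) - coefA m3 mu c s) / 4 by lra.
have b0 : 0 < (2 * Num.sqrt (Defs.coefB m3 mu c s) + coefA m3 mu c s) / 4 by lra.
split; rewrite ?sqrtr_eq0 -?ltNge// ?oppr_gt0//.
apply: (@quartet_eigenvalues _ _ _ _ _ (coefA m3 mu c s) (Defs.coefB m3 mu c s)).
- by rewrite char_poly_linearization// sqr_sqrtr ?oppr_ge0 ?(ltW Z0)// polyCN.
- by rewrite !sqr_sqrtr ?(ltW a0) ?(ltW b0)//; field.
- rewrite !sqr_sqrtr ?(ltW a0) ?(ltW b0)//.
  (* B is rewritten as the square of its root; its sign is then read off from sqrt B > 0, a
     consequence of [SA] and [A0]. *)
  rewrite -[LHS]sqr_sqrtr; first by field.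
  by rewrite ltW// -sqrtr_gt0; lra.
Qed.

Lemma rz_star_sqr_le c : c < 0 -> rz_star c ^+ 2 <= - 6 * c.
Proof.
move=> c0; have [r0 rE] := rz_starP c0.
by have := exprn_gt0 5 r0; lra.
Qed.

(** The difference of squares (7 / 2 + v - S) (7 / 2 + v + S) equals 9 / 4 d^2, at most 9 / 4, and
    its second factor is at least v. *)
Lemma sqrt_gap (S d v : R) : 0 < v -> 0 <= S -> 0 <= d <= 1 ->
  S ^+ 2 = (7 / 2 + v) ^+ 2 - 9 / 4 * d ^+ 2 ->
  0 <= 7 / 2 + v - S <= 9 / 4 / v.
Proof.
move=> v0 S0 /andP[d0 d1] S2.
have /andP[d20 d21] : 0 <= d ^+ 2 <= 1 by rewrite sqr_ge0 exprn_ile1.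
have Sv : S <= 7 / 2 + v by rewrite -(@ler_pXn2r _ 2)// ?nnegrE; lra.
rewrite subr_ge0 Sv /= ler_pdivlMr//.
have : (7 / 2 + v - S) * (7 / 2 + v + S) <= 9 / 4 by lra.
by apply: le_trans; rewrite ler_wpM2l; lra.
Qed.

(** For c > -1 / 6, r^2 <= - 6 c < 1 gives r <= 1, hence r^3 <= r^2 <= - 6 c. Then 1 - b^2 <= 9 / 8
    r^3 <= - 27 / 4 c. *)
Lemma sqr_imag_part c s : -1 / 6 < c < 0 -> 1 + 27 / 4 * c <= b c s ^+ 2 <= 1.
Proof.
move=> /andP[c1 c0]; have SA := sqrt_coefB_gt s c0.
have r0 := rz_star_gt0 c0; have r2 := rz_star_sqr_le c0.
rewrite sqr_sqrtr; last by lra.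
have u0 := rz_star_inv3_gt0 c0.
have r1 : rz_star c <= 1
  by rewrite -(@ler_pXn2r _ 2)// ?nnegrE ?(ltW r0)// expr1n; lra.
have r3 : rz_star c ^+ 3 <= - 6 * c.
  by rewrite exprS (le_trans _ r2)// ler_piMl ?sqr_ge0.
have dP := hill_d_itv01 c0.
rewrite coefAE//; rewrite coefAE// in SA.
have S0 := sqrtr_ge0 (Defs.coefB m3 mu c s).
have S2 : Num.sqrt (Defs.coefB m3 mu c s) ^+ 2 = Defs.coefB m3 mu c s.
  by rewrite sqr_sqrtr// ltW// -sqrtr_gt0; lra.
have /andP[S1 S3] := sqrt_gap u0 S0 dP (etrans S2 (coefBE m3 mu s c0)).
have : 9 / 4 / (rz_star c)^-1 ^+ 3 <= 9 / 4 * (- 6 * c).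
  by rewrite exprVn invrK ler_wpM2l//; lra.
by move=> ?; apply/andP; split; lra.
Qed.

Lemma cvg_sqr_imag_part s : b c s ^+ 2 @[c --> 0^'-] --> (1 : R).
Proof.
apply: (@squeeze_cvgr _ _ _ _ (fun c => 1 + 27 / 4 * c) (cst 1)).
- near=> c; apply: sqr_imag_part; apply/andP; split; near: c.
    by apply: nbhs_left_gt; lra.
  exact: nbhs_left_lt.
- apply: cvg_at_left_filter; rewrite -[X in _ --> X]addr0.
  rewrite -[X in _ --> _ + X](mulr0 (27 / 4)).
  by apply: cvgD; [exact: cvg_cst|apply: cvgMl_tmp; exact: cvg_id].
- exact: cvg_cst.
Unshelve. all: by end_near. Qed.

End Spectrum.

Theorem proposition4p2 (R : realType) (m3 : R) (m3_gt0 : 0 < m3)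
    (m3_lt1 : m3 < 1) (mu : R) (mu_gt0 : 0 < mu) (mu_le : mu <= 1 / 2)
    (s : bool) :
  (forall c : R, c < 0 ->
     [/\ Omega_zz m3 mu c s < 0, coefA m3 mu c s < 0, discD m3 mu c s < 0 &
         center_complex_saddle
           (linearization m3 mu c (z_equilibrium c s))]) /\
  (exists w a b : R -> R,
     (forall c : R, c < 0 ->
        center_quartet (linearization m3 mu c (z_equilibrium c s))
          (w c) (a c) (b c)) /\
     b c ^+ 2 @[c --> 0^'-] --> (1 : R)).
Proof.
split=> [c c0|].
  split; [exact: Omega_zz_lt0|exact: coefA_lt0|exact: discD_lt0|].
  by do 3!eexists; exact: hill_quartet.
(* Unification with [hill_quartet] fixes the three functions of c, and the same [b] then enters the
   limit. *)
by do 3!eexists; split=> [c c0|]; [exact: hill_quartet|exact: cvg_sqr_imag_part].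
Qed.
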